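(* Let $\mathbb{X}$ be a real normed linear space and let $x\in S_\mathbb{X}$. Then $x$ is $\rho$-left symmetric if and only if for every $y\in S_\mathbb{X}$ the following two conditions hold: (i) $y\in x^{\rho+}$ implies $x\in y^{\rho+}$; (ii) $y\in x^{\rho-}$ implies $x\in y^{\rho-}$.
   Context: All normed spaces are real; $S_\mathbb{X}=\{x\in\mathbb{X}:\|x\|=1\}$. Norm derivatives: $\rho'_{\pm}(x,y)=\|x\|\lim_{t\to 0^{\pm}}\frac{\|x+ty\|-\|x\|}{t}$ and $\rho'(x,y)=\frac12(\rho'_+(x,y)+\rho'_-(x,y))$. $\rho$-orthogonality: $x\perp_\rho y$ means $\rho'(x,y)=0$. An element $x\in\mathbb{X}$ is $\rho$-left symmetric if $x\perp_\rho y$ implies $y\perp_\rho x$ for all $y\in\mathbb{X}$. For $x,y\in\mathbb{X}$: $y\in x^{\rho+}$ means $\rho'(x,y)\ge 0$, and $y\in x^{\rho-}$ means $\rho'(x,y)\le 0$. *)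

(* Defs.v *)
From HB Require Import structures.
From mathcomp Require Import all_boot all_order all_algebra.
From mathcomp Require Import all_classical all_reals all_analysis.

Set Implicit Arguments.
Unset Strict Implicit.
Unset Printing Implicit Defensive.

Import Order.TTheory GRing.Theory Num.Theory.
Import numFieldNormedType.Exports.

Local Open Scope classical_set_scope.
Local Open Scope ring_scope.

Section NormDerivative.
Context {R : realType} {X : normedModType R}.
Implicit Types x y : X.

(* Both one-sided limits always exist, because t |-> `|x + t *: y| is convex,
   so the default value of lim is never used. *)
Definition norm_deriv_right x y : R :=
  `|x| * lim ((`|x + t *: y| - `|x|) / t @[t --> (0 : R)^'+]).

Definition norm_deriv_left x y : R :=
  `|x| * lim ((`|x + t *: y| - `|x|) / t @[t --> (0 : R)^'-]).

Definition norm_deriv x y : R :=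
  (norm_deriv_right x y + norm_deriv_left x y) / 2.

Definition rho_orthogonal x y : Prop := norm_deriv x y = 0.

Definition rho_left_symmetric x : Prop :=
  forall y, rho_orthogonal x y -> rho_orthogonal y x.

Definition rho_plus x : set X := [set y | 0 <= norm_deriv x y].

Definition rho_minus x : set X := [set y | norm_deriv x y <= 0].

End NormDerivative.

Definition unit_sphere {R : realType} (X : normedModType R) : set X :=
  [set x | `|x| = 1].
Arguments unit_sphere {R} X _.

(* Main.v *)
Require Import Defs.
From HB Require Import structures.
From mathcomp Require Import all_boot all_order all_algebra.
From mathcomp Require Import all_classical all_reals all_analysis.
From mathcomp Require Import ring lra.

Import Order.TTheory GRing.Theory Num.Theory.
Import numFieldNormedType.Exports.

Local Open Scope classical_set_scope.
Local Open Scope ring_scope.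

(** Let [x] be left symmetric with [c = rho'(x, y) > 0], and put
    [z = y - c x].  Then [rho'(x, z) = 0], so [rho'(z, x) = 0], which by
    convexity makes [t |-> |z + t x|] minimal at [t = 0].  Hence
    [|y - c x| <= |y|], so the left derivative of [t |-> |y + t x|] at [0] is
    nonnegative, and a fortiori so is the right one: [rho'(y, x) >= 0].
    The sign-reversed condition follows by applying this to [- y]. *)

Definition norm_slope {R : realType} {X : normedModType R} (x y : X) (t : R)
  : R := (`|x + t *: y| - `|x|) / t.

(** The right derivative of the norm at [x] along [y], without the factor [|x|]. Since the slopes
    are monotone in [t], the limit at [0^+] is an infimum, so later bounds come from evaluating a
    slope at a single [t]. *)
Definition norm_dd {R : realType} {X : normedModType R} (x y : X) : R :=
  inf (norm_slope x y @` `]0, +oo[).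

Lemma norm_slope_ge {R : realType} {X : normedModType R} (x y : X) (t : R) :
  0 < t -> - `|y| <= norm_slope x y t.
Proof.
move=> t0; rewrite /norm_slope ler_pdivlMr//.
have := ler_normB (x + t *: y) (t *: y).
by rewrite addrK normrZ (gtr0_norm t0); lra.
Qed.

(** Convexity of the norm: [x + s *: y] is the convex combination of [x] and [x + t *: y] with
    weight [s / t] on the latter. *)
Lemma norm_slope_nondecreasing {R : realType} {X : normedModType R}
    (x y : X) (s t : R) :
  0 < s -> s <= t -> norm_slope x y s <= norm_slope x y t.
Proof.
move=> s0 st; have t0 : 0 < t by exact: lt_le_trans st.
have st1 : s / t <= 1 by rewrite ler_pdivrMr// mul1r.
have e : x + s *: y = (1 - s / t) *: x + (s / t) *: (x + t *: y).
  by rewrite scalerDr scalerA addrA -scalerDl subrK scale1r divfK// gt_eqF.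
rewrite /norm_slope ler_pdivrMr// e.
apply: (@le_trans _ _ ((1 - s / t) * `|x| + (s / t) * `|x + t *: y| - `|x|)).
  rewrite lerD2r; apply: (le_trans (ler_normD _ _)).
  rewrite (normrZ (1 - s / t)) (normrZ (s / t)).
  by rewrite ger0_norm ?subr_ge0// ger0_norm// divr_ge0// ltW.
by rewrite le_eqVlt; apply/orP; left; apply/eqP; field; rewrite gt_eqF.
Qed.

Lemma norm_slope_lbound {R : realType} {X : normedModType R} (x y : X) :
  has_lbound (norm_slope x y @` `]0, +oo[).
Proof.
exists (- `|y|) => v [t /=]; rewrite in_itv/= andbT => t0 <-.
exact: norm_slope_ge.
Qed.

Lemma norm_dd_le {R : realType} {X : normedModType R} (x y : X) (t : R) :
  0 < t -> norm_dd x y <= norm_slope x y t.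
Proof.
move=> t0; apply: ge_inf; first exact: norm_slope_lbound.
by exists t => //=; rewrite in_itv/= t0.
Qed.

Lemma le_norm_dd {R : realType} {X : normedModType R} (x y : X) (a : R) :
  (forall t, 0 < t -> a <= norm_slope x y t) -> a <= norm_dd x y.
Proof.
move=> h; apply: lb_le_inf.
  by exists (norm_slope x y 1), 1 => //=; rewrite in_itv/= ltr01.
by move=> v [t /=]; rewrite in_itv/= andbT => t0 <-; exact: h.
Qed.

Lemma norm_slope_cvg_right {R : realType} {X : normedModType R} (x y : X) :
  norm_slope x y t @[t --> (0 : R)^'+] --> norm_dd x y.
Proof.
apply: nondecreasing_at_right_cvgr => //; last exact: norm_slope_lbound.
move=> s t; rewrite !in_itv/= !andbT => s0 _ st.
exact: norm_slope_nondecreasing.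
Qed.

(** The substitution of [- t] for [t] turns left slopes along [y] into negated right slopes along
    [- y]. *)
Lemma norm_slope_cvg_left {R : realType} {X : normedModType R} (x y : X) :
  norm_slope x y t @[t --> (0 : R)^'-] --> - norm_dd x (- y).
Proof.
apply/cvg_at_leftNP; rewrite oppr0.
rewrite (_ : _ \o _ = fun t => - norm_slope x (- y) t).
  by apply: cvgN; exact: norm_slope_cvg_right.
apply/funext => t /=.
by rewrite /norm_slope scaleNr scalerN invrN mulrN.
Qed.

Lemma norm_derivE {R : realType} {X : normedModType R} (x y : X) :
  norm_deriv x y = `|x| * (norm_dd x y - norm_dd x (- y)) / 2.
Proof.
rewrite /norm_deriv /norm_deriv_right /norm_deriv_left.
rewrite (cvg_lim _ (norm_slope_cvg_right x y))//.
by rewrite (cvg_lim _ (norm_slope_cvg_left x y))// -mulrDr.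
Qed.

(** Convexity again: [x + (m / 2) *: (y + z)] is the midpoint of [x + m *: y] and [x + m *: z]. *)
Lemma norm_ddD {R : realType} {X : normedModType R} (x y z : X) :
  norm_dd x (y + z) <= norm_dd x y + norm_dd x z.
Proof.
rewrite -lerBlDr; apply: le_norm_dd => s s0; rewrite lerBlDr -lerBlDl.
apply: le_norm_dd => u u0; rewrite lerBlDl.
(* Slopes are monotone, so both [s] and [u] may be lowered to a common step. *)
pose m := Num.min s u.
have m0 : 0 < m by rewrite lt_min s0.
apply: (@le_trans _ _ (norm_slope x y m + norm_slope x z m)); last first.
  by apply: lerD; apply: norm_slope_nondecreasing => //; rewrite ge_min lexx ?orbT.
apply: (le_trans (norm_dd_le _ _ (m / 2) _)); first by rewrite divr_gt0.
rewrite /norm_slope -mulrDl ler_pdivrMr ?divr_gt0//.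
have -> (a : R) : a / m * (m / 2) = a / 2 by field; rewrite gt_eqF.
rewrite -[X in X <= _](mulfK (_ : 2 != 0 :> R))// ler_pM2r// ?invr_gt0//.
have e : 2 *: (x + (m / 2) *: (y + z)) = (x + m *: y) + (x + m *: z).
  rewrite scalerDr scalerA mulrCA mulfV// mulr1 scalerDr addrACA.
  by rewrite scaler_nat mulr2n.
have := ler_normD (x + m *: y) (x + m *: z).
by rewrite -e normrZ (ger0_norm (ler0n _ 2)); lra.
Qed.

Lemma norm_ddZr {R : realType} {X : normedModType R} (x y : X) (a : R) :
  0 < a -> norm_dd x (a *: y) = a * norm_dd x y.
Proof.
(* One inequality for every positive factor suffices: the reverse one is its instance at [a^-1] and
   [a *: y]. *)
have ge b (v : X) : 0 < b -> b * norm_dd x v <= norm_dd x (b *: v).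
  move=> b0; apply: le_norm_dd => t t0.
  rewrite -ler_pdivlMl//; apply: (le_trans (norm_dd_le _ _ (t * b) _)).
    by rewrite mulr_gt0.
  rewrite /norm_slope scalerA le_eqVlt; apply/orP; left; apply/eqP.
  by field; rewrite !gt_eqF.
move=> a0; apply/eqP; rewrite eq_le ge// andbT.
have a'0 : 0 < a^-1 by rewrite invr_gt0.
have := ge a^-1 (a *: y) a'0.
by rewrite scalerA mulVf ?gt_eqF// scale1r ler_pdivrMl.
Qed.

Lemma norm_ddZl {R : realType} {X : normedModType R} (x y : X) (a : R) :
  0 < a -> norm_dd (a *: x) y = norm_dd x y.
Proof.
have ge b (v : X) : 0 < b -> norm_dd v y <= norm_dd (b *: v) y.
  move=> b0; apply: le_norm_dd => t t0.
  apply: (le_trans (norm_dd_le _ _ (t / b) _)); first by rewrite divr_gt0.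
  rewrite /norm_slope.
  have -> : b *: v + t *: y = b *: (v + (t / b) *: y).
    by rewrite scalerDr scalerA mulrCA mulfV ?mulr1// gt_eqF.
  rewrite !normrZ (gtr0_norm b0) le_eqVlt; apply/orP; left; apply/eqP.
  by field; rewrite !gt_eqF.
move=> a0; apply/eqP; rewrite eq_le ge// andbT.
have a'0 : 0 < a^-1 by rewrite invr_gt0.
have := ge a^-1 (a *: x) a'0.
by rewrite scalerA mulVf ?gt_eqF// scale1r.
Qed.

Lemma norm_ddN {R : realType} {X : normedModType R} (x y : X) :
  norm_dd (- x) y = norm_dd x (- y).
Proof.
congr (inf (_ @` _)); apply/funext => t.
by rewrite /norm_slope normrN scalerN -normrN opprD opprK.
Qed.

Lemma norm_dd0 {R : realType} {X : normedModType R} (x : X) :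
  norm_dd x 0 = 0.
Proof.
apply/eqP; rewrite eq_le; apply/andP; split.
  apply: (le_trans (norm_dd_le _ _ 1 _)) => //.
  by rewrite /norm_slope scaler0 addr0 subrr mul0r.
by apply: le_norm_dd => t _; rewrite /norm_slope scaler0 addr0 subrr mul0r.
Qed.

(** As [- norm_dd x (- y)] is the left derivative, this says that the right derivative dominates the
    left one. *)
Lemma norm_ddDN_ge0 {R : realType} {X : normedModType R} (x y : X) :
  0 <= norm_dd x y + norm_dd x (- y).
Proof. by have := norm_ddD x y (- y); rewrite subrr norm_dd0. Qed.

(** The slopes at [t = 1] bound both values from above; their sum is nonnegative, so both bounds are
    attained. *)
Lemma norm_dd_refl {R : realType} {X : normedModType R} (x : X) :
  norm_dd x x = `|x| /\ norm_dd x (- x) = - `|x|.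
Proof.
have h1 : norm_dd x x <= `|x|.
  apply: (le_trans (norm_dd_le _ _ 1 _)) => //.
  by rewrite /norm_slope scale1r divr1 lerBlDr; exact: ler_normD.
have h2 : norm_dd x (- x) <= - `|x|.
  apply: (le_trans (norm_dd_le _ _ 1 _)) => //.
  by rewrite /norm_slope scale1r divr1 subrr normr0 sub0r.
have := norm_ddDN_ge0 x x.
by split; lra.
Qed.

(** Along multiples of [x] the derivative is linear, so subadditivity, used to add [a *: x] and then
    to remove it, gives both inequalities. *)
Lemma norm_ddDZ {R : realType} {X : normedModType R} (x y : X) (a : R) :
  norm_dd x (y + a *: x) = norm_dd x y + a * `|x|.
Proof.
have dZ b : norm_dd x (b *: x) = b * `|x|.
  have [b0|b0|->] := ltgtP b 0.
  - have nb0 : 0 < - b by rewrite oppr_gt0.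
    have := norm_ddZr x (- x) _ nb0.
    by rewrite scalerN scaleNr opprK (norm_dd_refl x).2 mulrNN.
  - by rewrite norm_ddZr// (norm_dd_refl x).1.
  - by rewrite scale0r norm_dd0 mul0r.
apply/eqP; rewrite eq_le; apply/andP; split; first by rewrite -dZ norm_ddD.
have := norm_ddD x (y + a *: x) (- a *: x).
by rewrite {1}scaleNr addrK dZ mulNr lerBrDr.
Qed.

Lemma norm_derivNr {R : realType} {X : normedModType R} (x y : X) :
  norm_deriv x (- y) = - norm_deriv x y.
Proof. by rewrite !norm_derivE (opprK y); field. Qed.

Lemma norm_derivNl {R : realType} {X : normedModType R} (x y : X) :
  norm_deriv (- x) y = - norm_deriv x y.
Proof. by rewrite !norm_derivE normrN !norm_ddN (opprK y); field. Qed.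

Lemma norm_derivZr {R : realType} {X : normedModType R} (x y : X) (a : R) :
  0 < a -> norm_deriv x (a *: y) = a * norm_deriv x y.
Proof. by move=> a0; rewrite !norm_derivE -scalerN !norm_ddZr//; field. Qed.

Lemma norm_derivZl {R : realType} {X : normedModType R} (x y : X) (a : R) :
  0 < a -> norm_deriv (a *: x) y = a * norm_deriv x y.
Proof.
by move=> a0; rewrite !norm_derivE !norm_ddZl// normrZ gtr0_norm//; field.
Qed.

Lemma norm_derivDZ {R : realType} {X : normedModType R} (x y : X) (a : R) :
  norm_deriv x (y + a *: x) = norm_deriv x y + a * `|x| ^+ 2.
Proof. by rewrite !norm_derivE opprD -scaleNr !norm_ddDZ; field. Qed.

Lemma norm_deriv_eq0_le {R : realType} {X : normedModType R} (z x : X) (c : R) :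
  norm_deriv z x = 0 -> 0 < c -> `|z| <= `|z + c *: x|.
Proof.
move=> zx c0; have [->|z0] := eqVneq z 0; first by rewrite normr0.
have : 0 <= norm_slope z x c.
  apply: le_trans (norm_dd_le _ _ _ c0).
  (* Here [zx] makes [norm_dd z x] and [norm_dd z (- x)] equal; their sum is nonnegative, hence so
     is each. *)
  have := norm_ddDN_ge0 z x.
  move: zx; rewrite norm_derivE => /eqP.
  rewrite !mulf_eq0 normr_eq0 (negbTE z0) invr_eq0 pnatr_eq0 orbF/=.
  by rewrite subr_eq0 => /eqP <-; lra.
by rewrite /norm_slope pmulr_lge0 ?invr_gt0// subr_ge0.
Qed.

Lemma norm_deriv_ge0 {R : realType} {X : normedModType R} (x y : X) (c : R) :
  0 < c -> `|y - c *: x| <= `|y| -> 0 <= norm_deriv y x.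
Proof.
move=> c0 le_y; rewrite norm_derivE.
have dN : norm_dd y (- x) <= 0.
  apply: (le_trans (norm_dd_le _ _ _ c0)).
  by rewrite /norm_slope scalerN pmulr_lle0 ?invr_gt0// subr_le0.
have := norm_ddDN_ge0 y x => d0.
by rewrite divr_ge0// mulr_ge0//; lra.
Qed.

Lemma rho_left_symmetric_plus {R : realType} {X : normedModType R} (x y : X) :
  rho_left_symmetric x -> rho_plus x y -> rho_plus y x.
Proof.
rewrite /rho_plus/= => sx; rewrite le_eqVlt => /orP[/eqP/esym/sx ->//|xy0].
have x0 : 0 < `|x|.
  rewrite normr_gt0; apply/eqP => x0.
  by move: xy0; rewrite norm_derivE x0 normr0 !mul0r ltxx.
(* The coefficient for which [norm_derivDZ] makes [y - c *: x] orthogonal to [x]; [|x|] is arbitrary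
   here, hence the division. *)
pose c := norm_deriv x y / `|x| ^+ 2.
have c0 : 0 < c by rewrite divr_gt0// exprn_gt0.
have xz : rho_orthogonal x (y - c *: x).
  by rewrite /rho_orthogonal -scaleNr norm_derivDZ mulNr divfK ?subrr//
    expf_neq0// gt_eqF.
apply: (norm_deriv_ge0 _ _ c c0).
by have := norm_deriv_eq0_le _ _ c (sx _ xz) c0; rewrite subrK.
Qed.

Theorem theorem3p6 (R : realType) (X : normedModType R) (x : X)
    (hx : unit_sphere X x) :
  rho_left_symmetric x <->
  (forall y : X, unit_sphere X y ->
     (rho_plus x y -> rho_plus y x) /\ (rho_minus x y -> rho_minus y x)).
Proof.
split=> [sx y _|h y xy].
  split; first exact: rho_left_symmetric_plus.
  have := rho_left_symmetric_plus x (- y) sx.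
  by rewrite /rho_plus /rho_minus/= norm_derivNr norm_derivNl !oppr_ge0.
(* Any other [y] is normalised to apply [h]; positive scaling preserves the sign of [norm_deriv] in
   each argument. *)
have [->|y0] := eqVneq y 0; first by rewrite /rho_orthogonal norm_derivE normr0 !mul0r.
have ny0 : 0 < `|y| by rewrite normr_gt0.
have y'0 : 0 < `|y|^-1 by rewrite invr_gt0.
have [|] := h (`|y|^-1 *: y).
  by rewrite /unit_sphere/= normrZ (gtr0_norm y'0) mulVf// gt_eqF.
(* Orthogonality satisfies the premises of both sign conditions, whose conclusions are opposite
   inequalities. *)
rewrite /rho_plus /rho_minus/= norm_derivZr// norm_derivZl// xy mulr0 lexx.
rewrite pmulr_rge0// pmulr_rle0// => /(_ isT) ge0 /(_ isT) le0.
by apply/eqP; rewrite eq_le le0.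
Qed.
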